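(* Let $p(n)=\frac{\log n+c+o(1)}{n}\in[0,1]$ with $c=c(n)\in\omega(1)$. Then $$\lim_{n\to\infty}\mathrm{P}\bigl(G_{n,p(n)}\in\mathcal{D}^n\bigr)=1.$$ Likewise, for every sequence $q(n)$ with $0\le q(n)\le 1$, $$\lim_{n\to\infty}\mathrm{P}\bigl(G_{n,p(n)}^{q(n)}\in\mathcal{D}^n\bigr)=1.$$
   Context: A digraph $G=(V,E)$ on $n$ vertices has $V=\{1,\dots,n\}$ and $E\subseteq V\times V$ (self-loops $(i,i)$ allowed). Its structured matrix $\bar A\in\{0,*\}^{n\times n}$ has $\bar A_{ij}=*$ if $(i,j)\in E$ and $\bar A_{ij}=0$ otherwise. A realization of $\bar A$ is a real matrix obtained by assigning real numbers to the $*$ entries and keeping the zero entries. $G$ (equivalently $\bar A$) is structurally diagonalizable if for almost all (with respect to Lebesgue measure on $\mathbb{R}^{|E|}$) real assignments to the $*$ entries, the resulting matrix is diagonalizable (over $\mathbb{C}$). $\mathcal{D}^n$ is the set of structurally diagonalizable digraphs with $n$ vertices. In the random digraph model $\mathcal{G}(n,p,q)$ on $n$ labeled vertices, each ordered pair $(u,v)$ with $u\ne v$ is an edge with probability $p$, each self-loop $(u,u)$ is present with probability $q$, all independently. $\mathcal{G}(n,p)=\mathcal{G}(n,p,p)$. $G_{n,p(n)}$ denotes a random digraph sampled from $\mathcal{G}(n,p(n))$ and $G_{n,p(n)}^{q(n)}$ one sampled from $\mathcal{G}(n,p(n),q(n))$. $c\in\omega(1)$ means $c=c(n)\to+\infty$.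 *)

(* Defs.v *)
From HB Require Import structures.
From mathcomp Require Import all_boot all_order all_algebra.
From mathcomp Require Import complex.
From mathcomp Require Import all_classical all_reals all_analysis.

Set Implicit Arguments.
Unset Strict Implicit.
Unset Printing Implicit Defensive.

Import Order.TTheory GRing.Theory Num.Theory.
Import numFieldNormedType.Exports.

Local Open Scope classical_set_scope.
Local Open Scope ring_scope.

(* A digraph on n labelled vertices, the vertices being 0, ..., n-1: its edge
   set, self-loops allowed. *)
Notation digraph n := {set 'I_n * 'I_n}.

(* Lebesgue measure on R^k, as the k-fold product of Lebesgue measure on R:
   R^0 is a point of mass 1, and R^(k+1) is R x R^k via (x, t) |-> x :: t. *)
Fixpoint lebesgue_tuple (R : realType) (k : nat) :
    set (k.-tuple (measurableTypeR R)) -> \bar R :=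
  match k return set (k.-tuple (measurableTypeR R)) -> \bar R with
  | 0 => dirac [tuple]
  | k'.+1 => pushforward (lebesgue_measure \x @lebesgue_tuple R k')%E
               (fun xt => [tuple of xt.1 :: xt.2])
  end.
Arguments lebesgue_tuple R k : clear implicits.

(* The pattern {0,*}^(n x n) of a digraph, * being encoded by true. *)
Definition structured_matrix (n : nat) (E : digraph n) : 'M[bool]_n :=
  \matrix_(i, j) ((i, j) \in E).

(* The realization of the structured matrix of E by w in R^|E|: the * entry at
   the e-th edge, in the order of [enum E], is assigned the e-th coordinate
   of w. *)
Definition realization (R : realType) (n : nat) (E : digraph n)
    (w : #|E|.-tuple (measurableTypeR R)) : 'M[R]_n :=
  \matrix_(i, j)
    if structured_matrix E i j then nth 0 w (index (i, j) (enum E)) else 0.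

Definition structurally_diagonalizable (R : realType) (n : nat)
    (E : digraph n) : Prop :=
  \forall w \ae (lebesgue_tuple R #|E|),
    diagonalizable (map_mx (real_complex R) (realization w)).

Definition structurally_diagonalizable_set (R : realType) (n : nat) :
    set (digraph n) :=
  [set E | structurally_diagonalizable R E].
Arguments structurally_diagonalizable_set R n : clear implicits.

(* The point mass of E in G(n,p,q): independent edge indicators, with
   probability q on the diagonal and p off the diagonal. *)
Definition digraph_mass (R : realType) (n : nat) (p q : R) (E : digraph n) : R :=
  \prod_(uv : 'I_n * 'I_n)
    let r := if uv.1 == uv.2 then q else p in
    if uv \in E then r else 1 - r.

Definition digraph_prob (R : realType) (n : nat) (p q : R)
    (D : set (digraph n)) : R :=
  \sum_(E : digraph n | E \in D) digraph_mass p q E.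

(* Main.v *)
Require Import Defs.
From mathcomp Require Import all_boot all_order all_algebra all_fingroup separable.
From mathcomp Require Import complex polyorder polyrcf.
From mathcomp Require Import all_classical all_reals all_analysis.
From mathcomp Require Import measurable_realfun ring lra zify.

Set Implicit Arguments.
Unset Strict Implicit.
Unset Printing Implicit Defensive.

Import Order.TTheory GRing.Theory Num.Theory.
Import numFieldNormedType.Exports.

Local Open Scope classical_set_scope.
Local Open Scope ring_scope.

(** A digraph that contains the graph of a permutation is structurally
diagonalizable, and the off-diagonal part of a random digraph contains one
with probability tending to 1.

Let every edge i -> s i lie in E, for a permutation s. Give these edges positive
weights, constant along each cycle of s and different on different cycles, and
give weight 0 to all other edges. A power M^N of the resulting matrix M is
diagonal, with entries that tell the cycles apart; hence M is diagonalizable,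
an eigenvector of M lives on a single cycle, and it is determined by one of
its coordinates. So M has n distinct eigenvalues, and the resultant of the
characteristic polynomial with its derivative, which is a polynomial in the
edge weights, does not vanish at M. The zero set of a nonzero polynomial is
Lebesgue-null (slice along the first coordinate and apply Fubini), and outside
it the eigenvalues are distinct. This is [matching_structurally_diagonalizable].

If no permutation lies in E minus the loops, Hall's theorem gives a set of
rows, or of columns, with too few neighbours. A smallest such set S has exactly
#|S| - 1 neighbours, each of them adjacent to at least two points of S, and
2 #|S| <= n + 1 ([minimal_hall_violator]). A union bound over S, over its
neighbourhood and over the choice of two points of S for each neighbour gives
[unmatchable_prob], where only off-diagonal pairs are inspected, so that the bound
is uniform in q.
With L = n p = ln n + delta the sets of size 1 contribute O(n exp(-L)) =
O(exp(-delta)), and those of size s >= 2 contribute O(x^s) with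
x = O(L^2 exp(-L/4)). The sum is therefore O(1/delta)
([violator_sum_le_inv]), and delta = c + o(1) tends to infinity. *)

(** * Multivariate polynomials and their zero sets *)
Section IteratedPolynomials.
Variable R : comNzRingType.

(** Polynomials in k variables over R, one variable being adjoined at a time: the
outermost variable is the first coordinate of the points of R^k, as in the
recursive construction of Lebesgue measure on R^k. *)
Fixpoint iter_poly (k : nat) : comNzRingType :=
  if k is k'.+1 then {poly (iter_poly k')} else R.

Fixpoint iter_const (k : nat) : {rmorphism R -> iter_poly k} :=
  match k return {rmorphism R -> iter_poly k} with
  | 0 => idfun
  | k'.+1 => polyC \o iter_const k'
  end.

Fixpoint iter_eval (k : nat) : k.-tuple R -> {rmorphism iter_poly k -> R} :=
  match k return k.-tuple R -> {rmorphism iter_poly k -> R} with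
  | 0 => fun _ => idfun
  | k'.+1 => fun w =>
      horner_eval (thead w) \o map_poly (iter_eval [tuple of behead w])
  end.

(** Indices beyond the last variable give 0. *)
Fixpoint iter_var (k : nat) : nat -> iter_poly k :=
  match k return nat -> iter_poly k with
  | 0 => fun _ => 0
  | k'.+1 => fun i => if i is i'.+1 then (iter_var k' i')%:P else 'X
  end.

Lemma iter_evalS k (x : R) (t : k.-tuple R) (P : iter_poly k.+1) :
  iter_eval [tuple of x :: t] P = (map_poly (iter_eval t) P).[x].
Proof.
rewrite /= /horner_eval theadE; congr (map_poly _ P).[x].
by congr (_ (iter_eval _)); apply: val_inj.
Qed.

Lemma iter_eval_const k (w : k.-tuple R) x : iter_eval w (iter_const k x) = x.
Proof.
elim: k w => [|k IH] w //.
by rewrite (tuple_eta w) iter_evalS /= map_polyC hornerC /= IH.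
Qed.

Lemma iter_eval_var k (w : k.-tuple R) i : (i < k)%N ->
  iter_eval w (iter_var k i) = nth 0 w i.
Proof.
elim: k w i => [|k IH] w i //; rewrite (tuple_eta w) iter_evalS.
case: i => [_|i ik] /=; first by rewrite map_polyX hornerX.
by rewrite map_polyC hornerC /= IH.
Qed.

Lemma iter_eval_slice k (x : R) (t : k.-tuple R) (P : iter_poly k.+1) :
  iter_eval [tuple of x :: t] P = iter_eval t P.[iter_const k x].
Proof. by rewrite iter_evalS -horner_map /= iter_eval_const. Qed.

End IteratedPolynomials.
Arguments iter_var {R} k i.

Section NullSets.
Variable R : realType.

Lemma measurable_iter_eval k (P : iter_poly R k) :
  measurable_fun [set: k.-tuple (measurableTypeR R)]
    (fun w => iter_eval w P : measurableTypeR R).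
Proof.
elim: k P => [|k IH] P; first exact: measurable_cst.
have -> : (fun w : k.+1.-tuple (measurableTypeR R) => iter_eval w P) =
   fun w => \sum_(i < size P)
     iter_eval [tuple of behead w] P`_i * (thead w) ^+ i.
  apply/funext => w /=; rewrite /horner_eval horner_poly.
  by apply: eq_bigr.
apply: measurable_sum => i; apply: measurable_funM.
  exact: (measurableT_comp (IH P`_i)
    (@measurable_behead _ (measurableTypeR R) k)).
apply: (@measurable_funX _ _ R setT
  (fun w : k.+1.-tuple (measurableTypeR R) => thead w)).
exact: measurable_tnth.
Qed.

(** A function that vanishes outside a finite set is measurable whatever its
values there. In the Fubini step below, f x is the measure of a slice and F
contains the roots of a univariate polynomial. *)
Lemma integral_finite_support (f : R -> \bar R) (F : seq R) :
  (forall x, x \notin F -> f x = 0%E) ->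
  (\int[@lebesgue_measure R]_x f x)%E = 0%E.
Proof.
move=> f0.
have mF (A : set R) : A `<=` [set` F] -> measurable A.
  move=> AF; apply: countable_measurable; first by move=> t; exact: measurable_set1.
  by apply/finite_set_countable/(sub_finite_set AF)/finite_seq.
rewrite (@ae_eq_integral _ _ _ _ setT (cst 0%E)) ?integral0 //.
  move=> _ Y mY; rewrite setTI.
  have [Y0|Y0] := pselect (Y 0%E); last first.
    by apply: mF => x /= Yx; apply/negPn/negP => xF; apply: Y0; rewrite -(f0 x).
  rewrite -[X in measurable X]setCK; apply: measurableC; apply: mF => x /= Yx.
  by apply/negPn/negP => xF; apply: Yx; rewrite f0.
exists [set` F]; split.
- exact: mF.
- by apply: countable_lebesgue_measure0; apply/finite_set_countable/finite_seq.
- move=> x /= /not_implyP[_ fx]; apply/negPn/negP => xF; exact: fx (f0 x xF).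
Qed.

(** Evaluating the last k coordinates as in w0 leaves a nonzero univariate
polynomial q. Off the finitely many roots of q, the slice at x is the zero set
of a polynomial in k variables that is again nonzero at the tail of w0. *)
Lemma lebesgue_tuple_zero_set k (P : iter_poly R k) (w0 : k.-tuple R) :
  iter_eval w0 P != 0 ->
  lebesgue_tuple R k [set w | iter_eval w P = 0] = 0%E.
Proof.
elim: k P w0 => [|k IH] P w0.
  move=> /= P0; rewrite diracE memNset //= => /eqP; exact/negP.
case/tupleP: w0 => x0 t0.
rewrite iter_evalS; set q := map_poly _ _ => q0.
 have qN0 : q != 0 by apply: contraNneq q0 => ->; rewrite horner0.
have [rs rsP] : exists rs : seq R, forall x, root q x -> x \in rs.
  exists (polyrcf.rootsR q) => x qx.
  by have := polyrcf.roots_on_rootsR qN0 x; rewrite qx andbT => <-.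
rewrite /= /pushforward /product_measure1.
apply: (@integral_finite_support _ rs) => x xrs /=.
rewrite (_ : xsection _ _ = [set t | iter_eval t P.[iter_const R k x] = 0]); last first.
  apply/seteqP; split=> t; rewrite /xsection /= inE /=.
    by rewrite -iter_eval_slice.
  by rewrite -iter_eval_slice.
apply: (IH _ t0); rewrite -iter_eval_slice iter_evalS -/q.
by apply: contra xrs => /rsP.
Qed.
End NullSets.

(** * Matrices with simple spectrum *)
Lemma separable_coprimep (F : fieldType) (p : {poly F}) :
  coprimep p p^`() = separable_poly p.
Proof. by rewrite separable.separable_poly.unlock. Qed.

Section SimpleSpectrum.
Variable F : closedFieldType.

Lemma separable_diagonalizable n (A : 'M[F]_n.+1) :
  coprimep (char_poly A) (char_poly A)^`() -> diagonalizable A.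
Proof.
have [rs] := closed_field_poly_normal (char_poly A).
rewrite (monicP (char_poly_monic A)) scale1r => rsE.
rewrite rsE => sep; apply/diagonalizableP.
exists rs; last by rewrite -rsE mxminpoly_dvd_char.
by rewrite -separable_prod_XsubC -separable_coprimep.
Qed.

(** The eigenspaces add up to the whole space and have dimension at most 1, so
there are as many eigenvalues as the degree of the characteristic polynomial,
which is then the product of the corresponding distinct linear factors. *)
Lemma simple_eigenspaces_separable n (A : 'M[F]_n.+1) :
  diagonalizable A -> (forall a, (\rank (eigenspace A a) <= 1)%N) ->
  coprimep (char_poly A) (char_poly A)^`().
Proof.
move=> /diagonalizablePeigen[rs rs_uniq rs1] le1.
pose es := [seq r <- rs | eigenvalue A r].
have es_uniq : uniq es by exact: filter_uniq.
have es_root : all (root (char_poly A)) es.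
  by apply/allP => r; rewrite mem_filter eigenvalue_root_char => /andP[].
have size_es : size es = n.+1.
  apply/eqP; rewrite eqn_leq; apply/andP; split.
    rewrite -ltnS -(size_char_poly A) max_poly_roots //.
    by rewrite monic_neq0 ?char_poly_monic.
  rewrite -(mxrank1 F n.+1) -rs1 size_filter.
  elim: (rs) => [|r s IH]; first by rewrite big_nil mxrank0.
  rewrite big_cons /=; apply: (leq_trans (mxrank_adds_leqif _ _)).
  apply: leq_add IH; rewrite /eigenvalue -mxrank_eq0.
  by case: (\rank _) (le1 r) => [|[|]].
have pE : char_poly A = \prod_(z <- es) ('X - z%:P).
  rewrite {1}(all_roots_prod_XsubC _ es_root) ?uniq_rootsE ?size_es ?size_char_poly //.
  by rewrite (monicP (char_poly_monic A)) scale1r.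
by rewrite pE separable_coprimep separable_prod_XsubC.
Qed.

End SimpleSpectrum.

(** * Permutation matrices weighted by cycles *)
Section WeightedPermutation.
Variables (F : numClosedFieldType) (n : nat) (s : 'S_n.+1).

(** The weight depends only on the cycle of i, differs between cycles, and is
positive thanks to the successor. *)
Definition cycle_weight (i : 'I_n.+1) : nat := (enum_rank (porbit s i)).+1.
Local Notation d := cycle_weight.

Definition cycle_weight_mx : 'M[F]_n.+1 :=
  \matrix_(i, j) ((d i)%:R *+ (s i == j)).
Local Notation M := cycle_weight_mx.

Lemma cycle_weight_iter k i : d ((s ^+ k)%g i) = d i.
Proof. by rewrite /d porbit_perm. Qed.

Lemma cycle_weight_inj i j : d i = d j -> porbit s i = porbit s j.
Proof. by move=> [] /ord_inj/enum_rank_inj. Qed.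

Lemma cycle_weight_mxX k i j :
  (M ^+ k) i j = (d i)%:R ^+ k *+ ((s ^+ k)%g i == j).
Proof.
elim: k i j => [|k IH] i j.
  by rewrite !expr0 expg0 perm1 mxE.
rewrite exprSr mxE (bigD1 ((s ^+ k)%g i)) //= big1 ?addr0 => [|l ne].
  rewrite IH mxE eqxx cycle_weight_iter expgSr permM exprSr.
  by rewrite mulr1n mulrnAr.
by rewrite IH eq_sym (negPf ne) mul0r.
Qed.

Local Notation N := #[s]%g.

Lemma cycle_weight_mx_order :
  M ^+ N = diag_mx (\row_i ((d i)%:R ^+ N)).
Proof.
by apply/matrixP => i j; rewrite cycle_weight_mxX expg_order perm1 !mxE.
Qed.

(** With P the minimal polynomial of the diagonal matrix M^N, the polynomial
Q = P(X^N) kills M. It is separable: P has simple roots, and all of them are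
nonzero, so the factor N X^(N-1) of the derivative of Q does not vanish at a
root of Q. *)
Lemma diagonalizable_cycle_weight : diagonalizable M.
Proof.
pose P := mxminpoly (diag_mx (\row_i ((d i)%:R ^+ N : F))).
pose Q := P \Po 'X^N.
have MQ : horner_mx M Q = 0.
  rewrite /Q comp_polyE linear_sum /=.
  have := mx_root_minpoly (diag_mx (\row_i ((d i)%:R ^+ N : F))).
  rewrite -/P -{1}[P]coefK poly_def linear_sum /= => E; rewrite -[RHS]E.
  apply: eq_bigr => i _; rewrite !linearZ /= -exprM !rmorphXn /= !horner_mx_X.
  by rewrite -cycle_weight_mx_order exprM.
have PE : P = \prod_(r <- undup [seq (d i)%:R ^+ N | i <- enum 'I_n.+1]) ('X - r%:P).
  rewrite /P mxminpoly_diag; congr (\prod_(r <- undup _) _).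
  by apply: eq_map => i; rewrite mxE.
have sepP : coprimep P P^`().
  by rewrite PE separable_coprimep separable_prod_XsubC undup_uniq.
have N0 : N%:R != 0 :> F by rewrite pnatr_eq0 -lt0n order_gt0.
have sepQ : coprimep Q Q^`().
  apply: Pdiv.ClosedField.root_coprimep => x; rewrite root_comp !hornerE => Px.
  rewrite deriv_comp hornerM horner_comp derivXn hornerMn !hornerXn.
  rewrite mulf_neq0 //; first exact: (coprimep_root sepP Px).
  rewrite -mulr_natr mulf_neq0 // expf_neq0 //.
  apply: contraTneq Px => ->; rewrite expr0n gtn_eqF ?order_gt0 //=.
  rewrite PE root_prod_XsubC mem_undup; apply/mapP => -[i _ /esym/eqP].
  by rewrite expf_eq0 pnatr_eq0 andbF.
have [rs QE] := closed_field_poly_normal Q.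
have Q0 : lead_coef Q != 0.
  rewrite lead_coef_eq0; apply: contraTneq sepQ => ->.
  by rewrite deriv0 coprimep0 eqp_sym /eqp dvdp0 dvd0p oner_eq0.
apply/diagonalizableP; exists rs.
  rewrite -separable_prod_XsubC -separable_coprimep.
  by move: sepQ; rewrite QE derivZ coprimepZl // coprimepZr.
by have := mxminpoly_min MQ; rewrite QE dvdpZr.
Qed.

(** Following the cycle of i, an eigenvector u for a satisfies
a^k u(s^k i) = d(i)^k u(i). After a full turn this gives a^N = d(i)^N as soon as
u(i) is nonzero, so u lives on the only cycle whose weight fits, and there all
its coordinates follow from one of them. *)
Lemma eigenspace_cycle_weight a : (\rank (eigenspace M a) <= 1)%N.
Proof.
have [->|/rowV0Pn[v]] := eqVneq (eigenspace M a) 0; first by rewrite mxrank0.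
have evE (u : 'rV_n.+1) : (u <= eigenspace M a)%MS ->
    forall i k, a ^+ k * u 0 ((s ^+ k)%g i) = u 0 i * (d i)%:R ^+ k.
  move=> /eigenspaceP uM i; elim=> [|k IH].
    by rewrite !expr0 expg0 perm1 mulr1 mul1r.
  have := congr1 (fun w : 'rV_n.+1 => w 0 ((s ^+ k.+1)%g i)) uM.
  rewrite !mxE (bigD1 ((s ^+ k)%g i)) //= big1 ?addr0 => [|l ne].
    rewrite mxE expgSr permM eqxx mulr1n cycle_weight_iter => E.
    by rewrite exprSr -mulrA -E mulrA IH -mulrA -exprSr.
  by rewrite mxE expgSr permM (inj_eq perm_inj) (negPf ne) mulr0.
move=> vA v0.
have [i vi] : exists i, v 0 i != 0.
  by apply/existsP; apply: contra_neqT v0 => /existsPn v0; apply/rowP => i;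
    rewrite mxE; apply/eqP/negPn.
have aN (u : 'rV_n.+1) j : (u <= eigenspace M a)%MS -> u 0 j != 0 ->
    a ^+ N = (d j)%:R ^+ N.
  move=> uA uj; have := evE u uA j N; rewrite expg_order perm1 mulrC.
  by move/(mulfI uj).
have a0 : a != 0.
  apply: contraTneq isT => a0; have := aN v i vA vi.
  rewrite a0 expr0n gtn_eqF ?order_gt0 //= => /esym/eqP.
  by rewrite expf_eq0 pnatr_eq0 andbF.
rewrite (leq_trans _ (rank_leq_row v)) // mxrankS //; apply/rV_subP => u uA.
apply/sub_rVP; exists (u 0 i / v 0 i); apply/rowP => j; rewrite mxE.
have [/porbitP[k ->]|ij] := boolP (j \in porbit s i).
  apply: (mulfI (expf_neq0 k a0)); rewrite evE // mulrCA evE //.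
  by rewrite mulrA divfK.
have w0 (w : 'rV_n.+1) : (w <= eigenspace M a)%MS -> w 0 j = 0.
  move=> wA; apply: contraNeq ij => wj.
  rewrite -eq_porbit_mem; apply/eqP/cycle_weight_inj/eqP.
  rewrite -(eqn_exp2r _ _ (order_gt0 s)) -(eqr_nat F) !natrX.
  by rewrite -(aN w j wA wj) -(aN v i vA vi).
by rewrite !w0 // mulr0.
Qed.

End WeightedPermutation.

(** * Generic realizations *)
Section Genericity.

(** The dimensions of the Sylvester matrix are the only obstruction to commuting
a resultant with a morphism. *)
Lemma map_resultant_size (S T : nzRingType) (f : {rmorphism S -> T})
    (p q : {poly S}) :
  size (map_poly f p) = size p -> size (map_poly f q) = size q ->
  f (resultant p q) = resultant (map_poly f p) (map_poly f q).
Proof.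
move=> sp sq; rewrite /resultant -det_map_mx /Sylvester_mx sp sq.
rewrite map_col_mx; congr (\det (col_mx _ _));
  by apply: map_lin1_mx => v; rewrite /= map_poly_rV rmorphM /= map_rVpoly.
Qed.

Lemma size_map_deriv (S : nzRingType) (T : realFieldType)
    (f : {rmorphism S -> T}) (p : {poly S}) :
  p \is monic -> size (map_poly f p^`()) = size p^`().
Proof.
move=> p1; apply/eqP; rewrite eqn_leq size_poly /=.
have -> : size (map_poly f p^`()) = (size p).-1; last exact: size_poly.
rewrite -deriv_map size_deriv.
by rewrite size_map_poly_id0 // (monicP p1) rmorph1 oner_eq0.
Qed.

Variables (R : realType) (n : nat) (E : digraph n).

Definition generic_realization : 'M[iter_poly R #|E|]_n :=
  \matrix_(i, j)
    if (i, j) \in E then iter_var #|E| (index (i, j) (enum E)) else 0.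

Lemma map_generic_realization w :
  map_mx (iter_eval w) generic_realization = realization w.
Proof.
apply/matrixP => i j; rewrite !mxE; case: ifP => ijE; last by rewrite rmorph0.
by rewrite iter_eval_var // cardE index_mem mem_enum.
Qed.

(** Up to sign, the discriminant of the characteristic polynomial. *)
Definition generic_discriminant : iter_poly R #|E| :=
  resultant (char_poly generic_realization) (char_poly generic_realization)^`().

Lemma generic_discriminantE w :
  (iter_eval w generic_discriminant != 0) =
  coprimep (char_poly (realization w)) (char_poly (realization w))^`().
Proof.
rewrite map_resultant_size -?map_generic_realization -?map_char_poly ?deriv_map.
- rewrite resultant_eq0 -leqNgt /coprimep eqn_leq lt0n size_poly_eq0 gcdp_eq0.
  by rewrite map_char_poly negb_and monic_neq0 ?char_poly_monic ?andbT.
- by rewrite size_map_poly_id0 // (monicP (char_poly_monic _)) rmorph1 oner_eq0.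
- exact/size_map_deriv/char_poly_monic.
Qed.

Lemma coprime_realization_diagonalizable (m : nat) (M : 'M[R]_m.+1) :
  coprimep (char_poly M) (char_poly M)^`() ->
  diagonalizable (map_mx (real_complex R) M).
Proof.
move=> sep; apply: separable_diagonalizable.
by rewrite -map_char_poly deriv_map coprimep_map.
Qed.

End Genericity.

(** The cycle-weighted matrix of s is a realization of E at which the generic
discriminant does not vanish; so the discriminant is a nonzero polynomial and
its zero set is the null set that is required. *)
Lemma matching_structurally_diagonalizable (R : realType) (n : nat)
    (E : digraph n.+1) (s : 'S_n.+1) :
  (forall i, (i, s i) \in E) -> structurally_diagonalizable R E.
Proof.
move=> sE.
pose w0 : #|E|.-tuple R :=
  [tuple of map (fun e => (cycle_weight s e.1)%:R *+ (s e.1 == e.2)) (enum_tuple E)].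
have w0E : map_mx (real_complex R) (realization w0) = cycle_weight_mx _ s.
  apply/matrixP => i j; rewrite !mxE.
  case: ifP => ijE; last first.
    rewrite rmorph0; case: eqP => // sij; move: (sE i).
    by rewrite sij ijE.
  rewrite /= (nth_map (i, j)) ?index_mem ?mem_enum //.
  by rewrite nth_index ?mem_enum //= rmorphMn /= rmorph_nat.
have disc0 : iter_eval w0 (generic_discriminant R E) != 0.
  rewrite generic_discriminantE -(coprimep_map (real_complex R)).
  rewrite -deriv_map map_char_poly w0E.
  apply: simple_eigenspaces_separable (diagonalizable_cycle_weight _ s) _.
  exact: eigenspace_cycle_weight.
exists [set w | iter_eval w (generic_discriminant R E) = 0]; split.
- have := measurable_iter_eval (generic_discriminant R E).
  move=> /(_ measurableT _ (measurable_set1 0)); rewrite setTI.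
  exact.
- exact: lebesgue_tuple_zero_set disc0.
- move=> w /= nd; apply/eqP/negPn; apply: contra_notN nd => ev0.
  by apply: coprime_realization_diagonalizable; rewrite -generic_discriminantE.
Qed.

(** * Hall's theorem and minimal violators *)
Section Hall.
Import mathcomp.boot.fintype mathcomp.boot.finset.
Local Open Scope set_scope.
Variable T : finType.
Implicit Types (e : rel T) (A B S : {set T}).

Definition neighbours e S : {set T} := [set y | [exists x in S, e x y]].

Lemma neighboursP e S y :
  reflect (exists2 x, x \in S & e x y) (y \in neighbours e S).
Proof. by rewrite inE; apply: exists_inP. Qed.

(** Halmos and Vaughan's induction on S. If a nonempty proper subset A of S has no
more than #|A| neighbours, match A into them, and S minus A into the remaining
vertices, where Hall's condition still holds because A uses up exactly #|A|
neighbours. Otherwise every such subset has a neighbour to spare, and any edge at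
a point x can be used, since the other points lose at most one neighbour. *)
Lemma hall_injection e S :
  (forall A, A \subset S -> (#|A| <= #|neighbours e A|)%N) ->
  exists2 f : T -> T, {in S &, injective f} & {in S, forall x, e x (f x)}.
Proof.
have [k] := ubnP #|S|; elim: k => // k IH in e S *; rewrite ltnS => Sk hall.
have [->|[x xS]] := set_0Vmem S; first by exists id => // ?; rewrite inE.
have [/existsP[A /and3P[A0 AS NA]]|tightN] := boolP [exists A : {set T},
    [&& A != set0, A \proper S & (#|neighbours e A| <= #|A|)%N]].
  have sAS := proper_sub AS.
  (* A tight set A: match it first, then S minus A outside of its neighbours. *)
  have Ak : (#|A| < k)%N := leq_trans (proper_card AS) Sk.
  have [|f finj fe] := IH e A Ak.
    by move=> B BA; apply: hall; apply: subset_trans sAS.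
  pose e' : rel T := fun a b => e a b && (b \notin neighbours e A).
  have [||g ginj ge] := IH e' (S :\: A).
  - apply: leq_trans Sk; apply: proper_card.
    rewrite properEneq subsetDl andbT; apply: contraNneq A0 => SA.
    rewrite -subset0; apply/subsetP => a aA.
    by move: (subsetP sAS a aA); rewrite -SA inE aA.
  - move=> B; rewrite subsetD => /andP[BS BA].
    have := hall (A :|: B); rewrite subUset sAS BS => /(_ isT).
    have -> : #|A :|: B| = (#|A| + #|B|)%N.
      by rewrite cardsU setIC (disjoint_setI0 BA) cards0 subn0.
    have : (#|neighbours e (A :|: B)| <= #|neighbours e A| + #|neighbours e' B|)%N.
      apply: leq_trans (leq_card_setU _ _).
      apply/subset_leq_card/subsetP => y /neighboursP[a]; rewrite inE => aAB eay.
      rewrite inE; have [//|yN] := boolP (y \in neighbours e A).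
      apply/neighboursP; exists a; last by rewrite /e' eay.
      case/orP: aAB => // aA; case/negP: yN; apply/neighboursP; by exists a.
    by move: NA; lia.
  exists (fun a => if a \in A then f a else g a).
    move=> a b aS bS; have [aA|aA] := boolP (a \in A);
      have [bA|bA] := boolP (b \in A).
    - exact: finj.
    - move=> fg; have /ge/andP[_] : b \in S :\: A by rewrite inE bA.
      by case/neighboursP; exists a; rewrite // -fg fe.
    - move=> fg; have /ge/andP[_] : a \in S :\: A by rewrite inE aA.
      by case/neighboursP; exists b; rewrite // fg fe.
    - by apply: ginj; rewrite inE ?aA ?bA.
  move=> a aS; have [aA|aA] := boolP (a \in A); first exact: fe.
  by have /ge/andP[] : a \in S :\: A by rewrite inE aA.
(* No tight set: match x with any neighbour y and remove both. *)
have := hall [set x]; rewrite sub1set xS cards1 => /(_ isT)/card_gt0P[y].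
case/neighboursP => z /set1P-> exy.
pose e' : rel T := fun a b => e a b && (b != y).
have [||g ginj ge] := IH e' (S :\ x).
- by apply: leq_trans Sk; rewrite [leqRHS](cardsD1 x) xS.
- move=> A AS; have [->|A0] := eqVneq A set0; first by rewrite cards0.
  have : (#|A| < #|neighbours e A|)%N.
    rewrite ltnNge; apply: contra tightN => NA; apply/existsP; exists A.
    rewrite A0 NA andbT /=; apply: sub_proper_trans AS _.
    by rewrite properD1.
  rewrite (cardsD1 y (neighbours e A)) => NA.
  have /subset_leq_card : neighbours e A :\ y \subset neighbours e' A.
    apply/subsetP => b; rewrite !inE => /andP[bY /exists_inP[a aA eab]].
    by apply/exists_inP; exists a; rewrite // /e' eab.
  by move: NA; case: (_ \in _); lia.
exists (fun a => if a == x then y else g a).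
  move=> a b aS bS; have [->|ax] := eqVneq a x; have [->|bx] := eqVneq b x => //.
  - by move=> yg; have /ge/andP[_] : b \in S :\ x; rewrite ?inE ?bx // yg eqxx.
  - by move=> yg; have /ge/andP[_] : a \in S :\ x; rewrite ?inE ?ax // yg eqxx.
  - by apply: ginj; rewrite !inE ?ax ?bx.
move=> a aS; have [->//|ax] := eqVneq a x.
by have /ge/andP[] : a \in S :\ x by rewrite !inE ax.
Qed.

(** Hall's condition is considered on both sides of the bipartite graph, and b
selects the side that contains the violating set. *)
Definition flip_rel (b : bool) e : rel T := fun x y => if b then e y x else e x y.

(** Take a violating set S that is smallest among those of both sides, N being its
neighbourhood. Removing one point from S restores Hall's condition, so
#|N| = #|S| - 1 and no point of N has a single neighbour in S. Moreover the
complement of N violates Hall's condition on the other side, as its neighbours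
avoid S; hence S is no larger than this complement, which has n - #|S| + 1
points. *)
Lemma minimal_hall_violator e :
  ~ (exists s : {perm T}, forall x, e x (s x)) ->
  exists (b : bool) (S : {set T}), let N := neighbours (flip_rel b e) S in
  [/\ #|S| = #|N|.+1, (#|S|.*2 <= #|T|.+1)%N &
      forall y, y \in N -> (1 < #|[set x in S | flip_rel b e x y]|)%N].
Proof.
move=> noperm.
pose bad (bS : bool * {set T}) :=
  (#|neighbours (flip_rel bS.1 e) bS.2| < #|bS.2|)%N.
have [bS0 bad0] : exists bS, bad bS.
  apply: contrapT => nobad; apply: noperm.
  have [|f finj fe] := @hall_injection e setT.
    move=> A _; rewrite leqNgt; apply/negP => NA; apply: nobad.
    by exists (false, A).
  have injf : injective f by move=> x y; apply: finj; rewrite inE.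
  by exists (perm injf) => x; rewrite permE; apply: fe; rewrite inE.
case: (arg_minnP (fun bS : bool * {set T} => #|bS.2|) bad0) => -[b S] badS min_S.
rewrite /bad /= in badS; set N := neighbours _ _ in badS.
have min c A : (#|A| < #|S|)%N -> (#|A| <= #|neighbours (flip_rel c e) A|)%N.
  by rewrite !ltnNge; apply: contraR; rewrite -ltnNge => /(min_S (c, A)).
exists b, S => /=; rewrite -/N.
have NS x : x \in S -> (#|S| <= #|neighbours (flip_rel b e) (S :\ x)|.+1)%N.
  move=> xS; rewrite (cardsD1 x) xS ltnS; apply: min.
  by rewrite [ltnRHS](cardsD1 x) xS.
have subN x : neighbours (flip_rel b e) (S :\ x) \subset N.
  apply/subsetP => y /neighboursP[z]; rewrite !inE => /andP[_ zS] ezy.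
  by apply/exists_inP; exists z.
have cardS : #|S| = #|N|.+1.
  apply/eqP; rewrite eqn_leq badS andbT.
  have [x xS] : exists x, x \in S by apply/card_gt0P; exact: leq_ltn_trans badS.
  by apply: leq_trans (NS x xS) _; rewrite ltnS subset_leq_card.
split=> //.
- rewrite leqNgt; apply/negP; set t := #|T| => big.
  have cardCN : (#|N| + #|~: N| = t)%N by exact: cardsC.
  have cardCS : (#|S| + #|~: S| = t)%N by exact: cardsC.
  have NCS : (#|~: N| < #|S|)%N.
    by rewrite cardS -muln2 in big *; lia.
  have := min (~~ b) _ NCS.
  have /subset_leq_card : neighbours (flip_rel (~~ b) e) (~: N) \subset ~: S.
    apply/subsetP => x /neighboursP[y]; rewrite !inE => yN exy.
    apply: contra yN => xS; apply/exists_inP; exists x => //.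
    by move: exy; rewrite /flip_rel; case: (b).
  by lia.
- move=> y yN; rewrite ltnNge; apply/negP => few.
  have /neighboursP[x xS exy] := yN.
  have only z : z \in S -> flip_rel b e z y -> z = x.
    move=> zS ezy; move/card_le1_eqP: few; apply; by rewrite inE ?zS ?xS.
  have : (#|neighbours (flip_rel b e) (S :\ x)| < #|N|)%N.
    rewrite (cardsD1 y N) yN ltnS; apply/subset_leq_card/subsetP => z zN.
    rewrite in_setD1 (subsetP (subN x) _ zN) andbT; apply/eqP => zy.
    move: zN; rewrite zy => /neighboursP[w]; rewrite !inE => /andP[wx wS] ewy.
    by rewrite (only w) ?eqxx in wx.
  by have := NS x xS; rewrite cardS; lia.
Qed.

End Hall.

(** * The union bound *)
Section RandomDigraph.
Import mathcomp.boot.fintype mathcomp.boot.finset.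
Local Open Scope set_scope.
Variables (R : realType) (n : nat) (p q : R).
Hypotheses (p01 : 0 <= p <= 1) (q01 : 0 <= q <= 1).
Local Notation V := 'I_n.
Local Notation mass := (digraph_mass p q).
Implicit Types (E A B : digraph n) (S N : {set V}).

Lemma digraph_mass_ge0 E : 0 <= mass E.
Proof.
apply: prodr_ge0 => uv _ /=; case/andP: p01 => ? ?; case/andP: q01 => ? ?.
by case: ifP => _; case: ifP => _ //; rewrite subr_ge0.
Qed.

(** Expanding the product over all pairs of the sum of the two possible outcomes
gives the sum over all digraphs; suppressing the outcomes that contradict A
or B turns the factors indexed by A into p, those indexed by B into 1 - p, and
leaves the others equal to 1. *)
Lemma digraph_mass_cylinder A B :
  [disjoint A & B]%B -> (forall uv, uv \in A :|: B -> uv.1 != uv.2) ->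
  \sum_(E : digraph n | (A \subset E) && [disjoint B & E]%B) mass E =
  p ^+ #|A| * (1 - p) ^+ #|B|.
Proof.
move=> AB off; pose r (uv : V * V) := if uv.1 == uv.2 then q else p.
transitivity (\sum_(E in {set V * V}) \prod_uv
    (if uv \in E then r uv *+ (uv \notin B) else (1 - r uv) *+ (uv \notin A))).
  rewrite big_mkcond; apply: eq_bigr => E _; case: ifP => [/andP[AE BE]|].
    apply: eq_bigr => uv _; rewrite -/(r uv); case: ifP => uvE.
      by rewrite (disjointFl BE uvE).
    by rewrite (contraFF (subsetP AE uv) uvE).
  move/negbT; rewrite negb_and => /orP[/subsetPn[uv uvA uvE]|].
    by rewrite (bigD1 uv) //= (negPf uvE) uvA mulr0n mul0r.
  rewrite disjoint_subset => /subsetPn[uv uvB]; rewrite inE negbK => uvE.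
  by rewrite (bigD1 uv) //= uvE uvB mulr0n mul0r.
rewrite -(@bigA_distr R 0 1 *%R +%R).
transitivity (\prod_(uv : V * V) ((if uv \in A then p else 1) *
                                  (if uv \in B then 1 - p else 1))).
  apply: eq_bigr => uv _; have := off uv; rewrite inE.
  case: ifP => uvA; case: ifP => uvB /= offuv.
  - by move: uvB; rewrite (disjointFr AB).
  - by rewrite /r (negPf (offuv isT)) mulr1 mulr1n mulr0n addr0.
  - by rewrite /r (negPf (offuv isT)) mul1r mulr1n mulr0n add0r.
  - by rewrite mulr1 !mulr1n addrC subrK.
by rewrite big_split -!big_mkcond /= !prodr_const.
Qed.

Lemma digraph_mass_sum1 : \sum_(E : digraph n) mass E = 1.
Proof.
have disj0 E : [disjoint set0 & E]%B by rewrite disjoints_subset sub0set.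
have := @digraph_mass_cylinder set0 set0 (disj0 _).
rewrite cards0 !expr0 mulr1 => <- => [|uv]; last by rewrite !inE.
by apply: eq_bigl => E; rewrite sub0set disj0.
Qed.

Definition loopless_edge E : rel V := fun u v => ((u, v) \in E) && (u != v).

Definition unmatchable E : bool :=
  ~~ [exists s : {perm V}, forall u, loopless_edge E u (s u)].

(** The edge corresponding to the pair of x in the violating set and y on the
opposite side. *)
Definition orient (b : bool) (xy : V * V) : V * V :=
  if b then (xy.2, xy.1) else xy.

Lemma orient_inj b : injective (orient b).
Proof. by move=> [x y] [z t]; case: b => -[-> ->]. Qed.

Lemma orient_off_diagonal b xy : ((orient b xy).1 != (orient b xy).2) = (xy.1 != xy.2).
Proof. by case: b; rewrite // eq_sym. Qed.

Lemma flip_loopless_edge E b x y :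
  flip_rel b (loopless_edge E) x y = (orient b (x, y) \in E) && (x != y).
Proof. by case: b; rewrite // /flip_rel /loopless_edge eq_sym. Qed.

(** Here g sends each y in the neighbourhood N to two of its neighbours in the
violating set. *)
Definition forced_edges b N (g : {ffun V -> V * V}) : digraph n :=
  orient b @: ([set ((g y).1, y) | y in N] :|: [set ((g y).2, y) | y in N]).

Definition forbidden_edges b S N : digraph n :=
  orient b @: [set xy in setX S (~: N) | xy.1 != xy.2].

(** The default value y0 outside N makes g determined by its values on N, so that
these choices can be counted. *)
Definition admissible (y0 : V * V) S N (g : {ffun V -> V * V}) : bool :=
  (g \in pffun_on y0 (mem N) (mem (setX S S))) &&
  [forall y in N, [&& (g y).1 != (g y).2, (g y).1 != y & (g y).2 != y]].

Lemma forced_edges_card b y0 S N g :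
  admissible y0 S N g -> #|forced_edges b N g| = (#|N|.*2)%N.
Proof.
move=> /andP[_ /forall_inP ok]; rewrite /forced_edges card_imset; last exact: orient_inj.
have inj (h : V -> V) : injective (fun y => (h y, y)) by move=> y z [].
rewrite cardsU !card_imset //; rewrite -addnn disjoint_setI0 ?cards0 ?subn0 //.
rewrite disjoint_subset; apply/subsetP => _ /imsetP[y yN ->]; rewrite inE.
apply/imsetP => -[z zN [yz zy]]; have /and3P[+ _ _] := ok z zN.
by rewrite -yz zy eqxx.
Qed.

(** At most #|S| pairs of S x ~: N, which has #|S| (n - #|S| + 1) elements, are on
the diagonal. *)
Lemma forbidden_edges_card b S N : #|S| = #|N|.+1 ->
  (#|S| * (n - #|S|) <= #|forbidden_edges b S N|)%N.
Proof.
move=> cardS; rewrite /forbidden_edges card_imset; last exact: orient_inj.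
have : (#|setX S (~: N) :&: [set xy | xy.1 == xy.2]| <= #|S|)%N.
  rewrite -(card_in_imset (f := fst)); last first.
    by move=> [x y] [z t]; rewrite !inE /= => /andP[_ /eqP->] /andP[_ /eqP->] ->.
  by apply/subset_leq_card/subsetP => _ /imsetP[[x y] + ->]; rewrite !inE => /andP[/andP[]].
set D := [set xy | _] => leS.
have -> : [set xy in setX S (~: N) | xy.1 != xy.2] = setX S (~: N) :\: D.
  by apply/setP => xy; rewrite !inE andbC.
rewrite -(leq_add2l #|setX S (~: N) :&: D|) cardsID cardsX.
have cN : (#|N| + #|~: N|)%N = n by rewrite cardsC card_ord.
have -> : #|~: N| = (n - #|S|).+1.
  by rewrite cardS; move: (max_card (mem S)); rewrite card_ord cardS; lia.
by rewrite mulnS leq_add2r.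
Qed.

Lemma forced_forbidden_disjoint b S N g :
  [disjoint forced_edges b N g & forbidden_edges b S N]%B.
Proof.
rewrite disjoint_subset; apply/subsetP => _ /imsetP[[x y] xy ->].
rewrite inE mem_imset; last exact: orient_inj.
rewrite !inE negb_and negb_and /= negbK.
suff -> : y \in N by rewrite orbT.
by move: xy; rewrite inE => /orP[] /imsetP[z zN [_ ->]].
Qed.

Lemma config_edges_off_diagonal b y0 S N g uv : admissible y0 S N g ->
  uv \in forced_edges b N g :|: forbidden_edges b S N -> uv.1 != uv.2.
Proof.
move=> /andP[_ /forall_inP ok]; rewrite inE => /orP[] /imsetP[xy + ->];
  rewrite orient_off_diagonal; last by rewrite inE => /andP[].
by rewrite inE => /orP[] /imsetP[y yN ->] /=; have /and3P[] := ok y yN.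
Qed.

Lemma unmatchable_config (y0 : V * V) E : unmatchable E ->
  exists b S N g, [/\ #|S| = #|N|.+1, (#|S|.*2 <= n.+1)%N, admissible y0 S N g,
     forced_edges b N g \subset E & [disjoint forbidden_edges b S N & E]%B].
Proof.
move=> /existsPn noperm.
have [|b [S []]] := @minimal_hall_violator _ (loopless_edge E).
  by case=> s sE; case/negP: (noperm s); apply/forallP.
rewrite card_ord; set N := neighbours (flip_rel b (loopless_edge E)) S => cardS halfS two.
have /fin_all_exists[g gP] (y : V) : exists z : V * V,
    if y \in N then [&& z.1 \in S, z.2 \in S, z.1 != z.2,
      flip_rel b (loopless_edge E) z.1 y & flip_rel b (loopless_edge E) z.2 y]
    else z == y0.
  have [/two/card_gt1P[x [z []]]|_] := boolP (y \in N); last by exists y0.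
  rewrite !inE => /andP[xS xy] /andP[zS zy] xz.
  by exists (x, z); rewrite /= xS zS xz xy zy.
exists b, S, N, [ffun y => g y]; split=> //.
- apply/andP; split.
    apply/pfamilyP; split.
      apply/subsetP => y; rewrite inE /= ffunE; have := gP y.
      by case: ifP => // _ /eqP->; rewrite eqxx.
    by move=> y yN; have := gP y; rewrite ffunE yN !inE => /and5P[-> ->].
  apply/forall_inP => y yN; have := gP y; rewrite ffunE yN !flip_loopless_edge.
  by case/and5P=> _ _ -> /andP[_ ->] /andP[_ ->].
- apply/subsetP => _ /imsetP[xy + ->]; rewrite inE => /orP[] /imsetP[y yN ->];
    have := gP y; rewrite ffunE yN !flip_loopless_edge;
    by case/and5P=> _ _ _ /andP[? _] /andP[? _].
- rewrite disjoint_subset; apply/subsetP => _ /imsetP[[x y] + ->].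
  rewrite !inE => /andP[/andP[/= xS yN] xy]; apply: contra yN => xyE.
  by apply/exists_inP; exists x => //; rewrite flip_loopless_edge xyE.
Qed.

Lemma admissible_count y0 S N :
  (#|[set g | admissible y0 S N g]| <= (#|S| ^ 2) ^ #|N|)%N.
Proof.
have <- : #|setX S S| = (#|S| ^ 2)%N by rewrite cardsX mulnn.
rewrite -(card_pffun_on y0); apply/subset_leq_card/subsetP => g.
by rewrite inE => /andP[].
Qed.

(** Bounds the expected number of configurations (b, S, N, g) with #|S| = t + 1 and
#|N| = t: 2 choices of the side b, at most #|S|^2 of each pair g y, and
p^(2 t) (1 - p)^(#|S| (n - #|S|)) as the probability of each configuration. *)
Definition violator_bound (t : nat) : R :=
  (2 * 'C(n, t.+1) * 'C(n, t) * (t.+1 ^ 2) ^ t)%:R *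
  (p ^+ t.*2 * (1 - p) ^+ (t.+1 * (n - t.+1))).

Lemma unmatchable_prob (y0 : V * V) :
  \sum_(E : digraph n | unmatchable E) mass E <=
  \sum_(t < n.+1 | (t.+1.*2 <= n.+1)%N) violator_bound t.
Proof.
case/andP: p01 => p0 p1; have q0 : 0 <= 1 - p by rewrite subr_ge0.
pose C := (bool * ({set V} * {set V}))%type.
pose ok (c : C) := (#|c.2.1| == #|c.2.2|.+1) && (#|c.2.1|.*2 <= n.+1)%N.
pose h (t : nat) : R := p ^+ t.*2 * (1 - p) ^+ (t.+1 * (n - t.+1)).
pose hit (c : C) g E := (forced_edges c.1 c.2.2 g \subset E) &&
  [disjoint forbidden_edges c.1 c.2.1 c.2.2 & E]%B.
have h0 t : 0 <= h t by rewrite mulr_ge0 ?exprn_ge0.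
have m0 E : 0 <= mass E by exact: digraph_mass_ge0.
(* First moment: an unmatchable E hits at least one configuration. *)
apply: (@le_trans _ _ (\sum_(c : C | ok c)
    \sum_(g | admissible y0 c.2.1 c.2.2 g) \sum_(E : digraph n | hit c g E) mass E)).
  rewrite pair_big_dep /= (exchange_big_dep predT) //= [leLHS]big_mkcond.
  apply: ler_sum => E _; case: ifP => [|_]; last exact: sumr_ge0.
  case/(unmatchable_config y0) => b [S [N [g [SN Sn adm fE dE]]]].
  rewrite (bigD1 ((b, (S, N)), g)) /=; last by rewrite /ok /hit /= Sn SN eqxx adm fE dE.
  by rewrite lerDl sumr_ge0.
apply: (@le_trans _ _ (\sum_(c : C | ok c)
    (((#|c.2.2|.+1 ^ 2) ^ #|c.2.2|)%:R * h #|c.2.2|))).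
  apply: ler_sum => -[b [S N]] /andP[/= /eqP SN Sn].
  apply: (@le_trans _ _ (\sum_(g in [set g | admissible y0 S N g]) h #|N|)).
    rewrite [leRHS](eq_bigl (admissible y0 S N)); last by move=> g; rewrite inE.
    apply: ler_sum => g adm; rewrite digraph_mass_cylinder.
    - rewrite (forced_edges_card _ adm) ler_wpM2l ?exprn_ge0 //.
      rewrite ler_wiXn2l //; first by rewrite gerBl.
      by rewrite -SN; apply: forbidden_edges_card.
    - exact: forced_forbidden_disjoint.
    - by move=> uv; apply: config_edges_off_diagonal adm.
  rewrite sumr_const -[leLHS]mulr_natl ler_wpM2r // ler_nat -SN.
  exact: admissible_count.
(* Group the configurations by t = #|N|. *)
rewrite (partition_big (fun c : C => inord #|c.2.2| : 'I_n.+1)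
  (fun t => (t.+1.*2 <= n.+1)%N)) /=; last first.
  move=> -[b [S N]] /andP[/= /eqP SN Sn]; rewrite inordK; first by rewrite -SN.
  by rewrite ltnS -[leqRHS](card_ord n) max_card.
apply: ler_sum => t tn.
apply: (@le_trans _ _ (\sum_(c in setX [set: bool]
    (setX [set S : {set V} | #|S| == t.+1] [set N : {set V} | #|N| == t]))
    ((t.+1 ^ 2) ^ t)%:R * h t)).
  have Ncard (c : C) : inord #|c.2.2| = t -> #|c.2.2| = t.
    move=> <-; rewrite inordK // ltnS -[leqRHS](card_ord n); exact: max_card.
  rewrite big_mkcond [leRHS]big_mkcond /=; apply: ler_sum => -[b [S N]] _.
  case: ifP => [/andP[/andP[/= /eqP SN _] /eqP Nt]|_].
    by rewrite !inE /= SN (Ncard (b, (S, N)) Nt) !eqxx.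
  by case: ifP => // _; rewrite mulr_ge0 ?ler0n.
rewrite sumr_const -[leLHS]mulr_natl mulrA -natrM !cardsX cardsT card_bool !card_draws.
by rewrite card_ord !mulnA.
Qed.

End RandomDigraph.

(** * Asymptotics of the union bound *)
Section ViolatorEstimates.
Variable R : realType.

Lemma self_power_le_expR_fact s : (s ^ s)%:R <= expR s%:R * s`!%:R :> R.
Proof.
elim: s => [|s IH]; first by rewrite expR0 mul1r.
have step : (s.+1 ^ s)%:R <= expR 1 * (s ^ s)%:R :> R.
  case: s {IH} => [|s]; first by rewrite expn0 mulr1 (le_trans _ (expR_ge1Dx 1)) ?lerDl.
  have s0 : (0 : R) < s.+1%:R by rewrite ltr0n.
  have -> : expR 1 = expR (s.+1%:R^-1) ^+ s.+1 :> R.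
    by rewrite -expRM_natl mulfV // gt_eqF.
  rewrite !natrX -exprMn lerXn2r ?nnegrE ?mulr_ge0 ?expR_ge0 ?ler0n //.
  apply: le_trans (ler_wpM2r (ltW s0) (expR_ge1Dx _)).
  by rewrite mulrDl mulVf ?gt_eqF // mul1r -natr1 addrC.
have {}step := le_trans step (ler_wpM2l (expR_ge0 1) IH).
rewrite expnS natrM factS natrM.
have -> : expR s.+1%:R * (s.+1%:R * s`!%:R) =
    s.+1%:R * (expR 1 * (expR s%:R * s`!%:R)) :> R.
  by rewrite -natr1 expRD; ring.
by rewrite ler_wpM2l.
Qed.

(** With s = t + 1, use C(n, s) s! <= n^s, C(n, t) t! <= n^t and s^s <= e^s s!. Both
sides are multiplied by s^2 in order to compare s^(2 s) with (s!)^2. *)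
Lemma bin_product_bound n t :
  ('C(n, t.+1) * 'C(n, t) * (t.+1 ^ 2) ^ t)%:R <=
  expR 2 ^+ t.+1 * n%:R ^+ (t.*2.+1) :> R.
Proof.
have binle m : ('C(n, m) * m`! <= n ^ m)%N.
  rewrite bin_ffact; elim: m => // m IH.
  by rewrite ffactnSr expnSr leq_mul ?leq_subr.
have s0 : (0 : R) < (t.+1 ^ 2)%:R by rewrite ltr0n expn_gt0.
rewrite -(ler_pM2r s0) -natrM -!mulnA -expnSr.
have -> : ((t.+1 ^ 2) ^ t.+1 = t.+1 ^ t.+1 * t.+1 ^ t.+1)%N by rewrite -expnM mulnC expnM mulnn.
rewrite !mulnA natrM natrM.
have sq := self_power_le_expR_fact t.+1.
apply: (@le_trans _ _ (('C(n, t.+1) * 'C(n, t))%:R *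
  ((expR t.+1%:R * t.+1`!%:R) * (expR t.+1%:R * t.+1`!%:R)))).
  by rewrite -mulrA; apply: ler_wpM2l => //; apply: ler_pM.
have -> : expR t.+1%:R * t.+1`!%:R * (expR t.+1%:R * t.+1`!%:R) =
    expR 2 ^+ t.+1 * (t.+1`! * t.+1`!)%:R :> R.
  by rewrite mulrACA -expRD -natrM -expRM_natl -mulr2n -[_ *+ 2]mulr_natr.
rewrite mulrCA -natrM -mulrA ler_wpM2l ?exprn_ge0 ?expR_ge0 //.
rewrite -natrX -natrM ler_nat.
have := leq_mul (leq_mul (binle t.+1) (binle t)) (leqnn t.+1).
rewrite factS -expnD addSn addnn => H.
apply: leq_trans (_ : (n ^ t.*2.+1 * t.+1 <= _)%N); last by rewrite leq_mul // leq_pmulr.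
by apply: leq_trans H; apply: eq_leq; ring.
Qed.

Lemma one_sub_power_le_expR (p : R) m :
  p <= 1 -> (1 - p) ^+ m <= expR (- (p * m%:R)).
Proof.
move=> p1; rewrite -mulNr mulrC expRM_natl lerXn2r ?nnegrE ?subr_ge0 ?expR_ge0 //.
exact: expR_ge1Dx.
Qed.

Lemma violator_bound0 n (p : R) : 0 <= p <= 1 ->
  violator_bound n p 0 <= 2 * expR 1 * (n%:R * expR (- (n%:R * p))).
Proof.
case/andP=> p0 p1; rewrite /violator_bound bin1 bin0 double0 expr0 mul1r mul1n.
rewrite muln1 expn0 muln1 natrM -!mulrA ler_wpM2l // mulrCA ler_wpM2l ?ler0n //.
apply: (le_trans (one_sub_power_le_expR _ p1)); rewrite -expRD ler_expR.
case: n => [|n]; first by rewrite sub0n mulr0 mul0r oppr0 addr0 ler01.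
by rewrite subn1 /= -natr1 mulrDl mul1r mulrC; lra.
Qed.

(** The point is that s (n - s) / n >= 1 + s / 4 for 2 <= s <= (n + 1) / 2 and
n >= 10, by concavity in s. The summand 1 yields a factor exp(-L) that absorbs
the factor n, and s / 4 yields the geometric decay. *)
Lemma violator_bound_large n t (p L : R) : 0 <= p <= 1 -> n%:R * p = L ->
  (0 < t)%N -> (t.+1.*2 <= n.+1)%N -> (10 <= n)%N ->
  1 <= L -> n%:R * expR (- L) <= 1 ->
  violator_bound n p t <= 2 * (expR 2 * L ^+ 2 * expR (- (L / 4))) ^+ t.+1.
Proof.
case/andP=> p0 p1 LE t0 tn n10 L1 nL.
have L0 : 0 <= L by exact: le_trans L1.
have n0 : (0 : R) < n%:R by rewrite ltr0n; lia.
rewrite /violator_bound -!mulnA natrM -!mulrA ler_wpM2l //.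
apply: (@le_trans _ _ ((expR 2 ^+ t.+1 * n%:R ^+ (t.*2.+1)) *
    (p ^+ t.*2 * expR (- (p * (t.+1 * (n - t.+1))%:R))))).
  rewrite ler_pM ?ler0n ?mulr_ge0 ?exprn_ge0 ?subr_ge0 //.
    by rewrite !mulnA bin_product_bound.
  by rewrite ler_wpM2l ?exprn_ge0 // one_sub_power_le_expR.
rewrite !exprMn -!mulrA ler_wpM2l ?exprn_ge0 ?expR_ge0 //.
have gap : p * (t.+1 * (n - t.+1))%:R >= L + t.+1%:R * (L / 4).
  (* This follows from (t - 1) (n + 1 - 2 (t + 1)) >= 0 and n >= 10. *)
  have : (n * (4 + t.+1) <= 4 * (t.+1 * (n - t.+1)))%N.
    have : (t.+1 <= n)%N by lia.
    move=> /subnKC; set m := (n - t.+1)%N => nE.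
    by move: tn n10; rewrite -nE -muln2; nia.
  rewrite -(ler_nat R) [leRHS]natrM !natrM natrD => H.
  have := ler_wpM2l p0 H; rewrite -LE; set a := t.+1%:R; set b := (n - t.+1)%:R.
  by move=> H'; nra.
apply: (@le_trans _ _ (n%:R *
    (L ^+ t.*2 * (expR (- L) * expR (- (t.+1%:R * (L / 4))))))).
  rewrite exprS -mulrA ler_wpM2l ?ler0n // mulrA -exprMn LE.
  by rewrite ler_wpM2l ?exprn_ge0 // -expRD ler_expR -opprD lerN2.
rewrite -mulrN expRM_natl; set y := _ ^+ t.+1.
have y0 : 0 <= y by rewrite exprn_ge0 ?expR_ge0.
rewrite [leRHS]mulrA -exprD addnn.
have -> : n%:R * (L ^+ t.*2 * (expR (- L) * y)) =
    (n%:R * expR (- L)) * (L ^+ t.*2 * y) by ring.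
apply: (@le_trans _ _ (L ^+ t.*2 * y)).
  by rewrite ler_piMl // mulr_ge0 ?exprn_ge0.
by rewrite ler_wpM2r // ler_weXn2l // leq_double.
Qed.

(** The ratio x of the geometric bound is at most 1728 e^2 / delta, because
exp(L / 4) = exp(L / 12)^3 >= (L / 12)^3. The hypothesis on delta makes it at most
1/2, so that the terms of the sum with t > 0 add up to at most 4 x. *)
Lemma violator_sum_estimate n (p delta : R) : (10 <= n)%N -> 0 <= p <= 1 ->
  n%:R * p = ln n%:R + delta -> 3456 * expR 2 <= delta ->
  \sum_(t < n.+1 | (t.+1.*2 <= n.+1)%N) violator_bound n p t <=
  (2 * expR 1 + 6912 * expR 2) / delta.
Proof.
move=> n10 p01 Lnd dbig.
have n0 : (0 : R) < n%:R by rewrite ltr0n (leq_trans _ n10).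
have e2 : 1 <= expR 2 :> R by rewrite (le_trans _ (expR_ge1Dx 2)) // lerDl.
have d0 : 0 < delta by lra.
move: Lnd; move LE : (n%:R * p) => L Lnd.
have dL : delta <= L by rewrite Lnd lerDr ln_ge0 // ler1n (leq_trans _ n10).
have L0 : 0 < L by exact: lt_le_trans dL.
have nL : n%:R * expR (- L) = expR (- delta).
  by rewrite Lnd opprD expRD (expRN (ln _)) lnK ?posrE // mulrA mulfV ?mul1r // gt_eqF.
have ed : expR (- delta) <= delta^-1.
  rewrite expRN lef_pV2 ?posrE ?expR_gt0 //.
  by apply: le_trans (expR_ge1Dx _); rewrite lerDr.
pose x := expR 2 * L ^+ 2 * expR (- (L / 4)).
have x0 : 0 <= x.
  by apply: mulr_ge0 (expR_ge0 _); apply: mulr_ge0 (expR_ge0 _) (sqr_ge0 _).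
have xL : x <= 1728 * expR 2 / delta.
  have : (L / 12) ^+ 3 <= expR (L / 4).
    have -> : L / 4 = 3%:R * (L / 12) by lra.
    rewrite expRM_natl lerXn2r ?nnegrE ?expR_ge0 ?divr_ge0 ?ltW //.
    by apply: lt_le_trans (expR_ge1Dx _); rewrite ltrDr.
  rewrite expr_div_n ler_pdivrMr ?exprn_gt0 // => cube; rewrite ler_pdivlMr //.
  apply: (@le_trans _ _ (x * L)); first by rewrite ler_wpM2l.
  have -> : x * L = expR 2 * (L ^+ 3 / expR (L / 4)).
    by rewrite /x expRN [L ^+ 3]exprSr !mulrA [LHS]mulrAC.
  rewrite [leRHS]mulrC ler_wpM2l ?expR_ge0 // ler_pdivrMr ?expR_gt0 //.
  by rewrite mulrC (le_trans cube) // ler_wpM2l ?expR_ge0 //; lra.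
have xhalf : x <= 2^-1.
  by rewrite (le_trans xL) // ler_pdivrMr //; lra.
have geom m : \sum_(t < m) x ^+ t <= 2.
  elim: m => [|m IH]; first by rewrite big_ord0.
  rewrite big_ord_recl expr0; under eq_bigr do rewrite exprS.
  rewrite -mulr_sumr.
  have s0 : 0 <= \sum_(t < m) x ^+ t by apply: sumr_ge0 => t _; rewrite exprn_ge0.
  by nra.
have bound0 := violator_bound0 n p01; rewrite LE in bound0.
rewrite big_mkcond big_ord_recl /= mulrDl.
apply: (@le_trans _ _ (2 * expR 1 * expR (- delta) + \sum_(t < n) 2 * (x * x ^+ t))).
  apply: lerD.
    case: ifP => _; first by rewrite -nL.
    by rewrite !mulr_ge0 ?expR_ge0.
  apply: ler_sum => t _; case: ifP => [tn|_]; last first.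
    by apply: mulr_ge0 => //; apply: mulr_ge0 x0 (exprn_ge0 _ x0).
  apply: le_trans (violator_bound_large p01 LE _ tn n10 _ _) _ => //.
  - by rewrite (le_trans _ dL) //; lra.
  - by rewrite nL (le_trans ed) // invf_le1 //; lra.
  - rewrite -/x ler_wpM2l // exprS ler_wpM2l // exprS ler_piMl ?exprn_ge0 //; lra.
apply: lerD; first by rewrite ler_wpM2l ?mulr_ge0 ?expR_ge0.
rewrite -!mulr_sumr (le_trans (_ : _ <= 2 * (x * 2))) //.
  by rewrite !ler_wpM2l.
by clearbody x; move: xL; rewrite -!mulrA; set y := _ / delta; lra.
Qed.

Lemma violator_sum_le_inv : exists2 K : R, 0 < K & forall n (p delta : R),
  (10 <= n)%N -> 0 <= p <= 1 -> n%:R * p = ln n%:R + delta -> K <= delta ->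
  \sum_(t < n.+1 | (t.+1.*2 <= n.+1)%N) violator_bound n p t <= K / delta.
Proof.
have e1 := expR_gt0 (1 : R); have e2 := expR_gt0 (2 : R).
exists (2 * expR 1 + 6912 * expR 2); first by lra.
move=> n p delta n10 p01 Ln Kd; apply: violator_sum_estimate => //; lra.
Qed.

End ViolatorEstimates.

(** * The limit *)

Lemma matchable_structurally_diagonalizable (R : realType) (n : nat)
    (E : digraph n.+1) :
  ~~ unmatchable E -> structurally_diagonalizable R E.
Proof.
rewrite negbK => /existsP[s /forallP sE].
by apply: (@matching_structurally_diagonalizable _ _ _ s) => i; have /andP[] := sE i.
Qed.

Lemma digraph_prob_structurally_diagonalizable (R : realType) (n : nat)
    (p q : R) (B : R) : (0 < n)%N -> 0 <= p <= 1 -> 0 <= q <= 1 ->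
  \sum_(t < n.+1 | (t.+1.*2 <= n.+1)%N) violator_bound n p t <= B ->
  1 - B <= digraph_prob p q (structurally_diagonalizable_set R n) <= 1.
Proof.
case: n => // n _ p01 q01 boundB; set D := structurally_diagonalizable_set R n.+1.
have m0 (E : digraph n.+1) : 0 <= digraph_mass p q E by exact: digraph_mass_ge0.
have total : digraph_prob p q D +
    \sum_(E : digraph n.+1 | E \notin D) digraph_mass p q E = 1.
  by rewrite -(digraph_mass_sum1 n.+1 p q) [RHS](bigID (fun E => E \in D)).
have fail : \sum_(E : digraph n.+1 | E \notin D) digraph_mass p q E <= B.
  apply: le_trans boundB; apply: le_trans (unmatchable_prob p01 q01 (ord0, ord0)).
  rewrite big_mkcond [leRHS]big_mkcond; apply: ler_sum => E _.
  case: ifPn => [ED|_]; last by case: ifP.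
  case: ifPn => // /(@matchable_structurally_diagonalizable R) DE.
  by case/negP: ED; rewrite inE.
have fail0 : 0 <= \sum_(E : digraph n.+1 | E \notin D) digraph_mass p q E.
  exact: sumr_ge0.
by rewrite -total lerDl fail0 andbT lerBlDr lerD2l.
Qed.

Theorem mainTheorem1 (R : realType) (p c e : nat -> R)
    (p01 : forall n : nat, (0 < n)%N -> 0 <= p n <= 1)
    (pE : forall n : nat, (0 < n)%N ->
      p n = (ln n%:R + c n + e n) / n%:R)
    (c_oo : c n @[n --> \oo] --> +oo)
    (e_o1 : e n @[n --> \oo] --> (0 : R)) :
  (digraph_prob (p n) (p n) (structurally_diagonalizable_set R n)
     @[n --> \oo] --> (1 : R)) /\
  (forall q : nat -> R, (forall n : nat, (0 < n)%N -> 0 <= q n <= 1) ->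
   digraph_prob (p n) (q n) (structurally_diagonalizable_set R n)
     @[n --> \oo] --> (1 : R)).
Proof.
suff main (q : nat -> R) : (forall n : nat, (0 < n)%N -> 0 <= q n <= 1) ->
    digraph_prob (p n) (q n) (structurally_diagonalizable_set R n)
      @[n --> \oo] --> (1 : R).
  by split; [exact: main | exact: main].
have [K K0 sumK] := violator_sum_le_inv R.
move=> q01; apply/cvgrPdist_le => eps eps0; near=> n.
have n10 : (10 <= n)%N by near: n; exact: nbhs_infty_ge.
have n0 : (0 < n)%N by exact: leq_trans n10.
have en : `|0 - e n| <= 1 by near: n; move/cvgrPdist_le: e_o1; apply.
have c1 : K + 1 <= c n by near: n; move/cvgryPge: c_oo; apply.
have c2 : K / eps + 1 <= c n by near: n; move/cvgryPge: c_oo; apply.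
have en1 : -1 <= e n by move: en; rewrite sub0r normrN ler_norml => /andP[].
have np : n%:R * p n = ln n%:R + (c n + e n).
  by rewrite pE // addrA mulrC divfK // pnatr_eq0 -lt0n.
have d1 : K <= c n + e n by lra.
have d2 : K / eps <= c n + e n by lra.
have d0 : 0 < c n + e n by apply: lt_le_trans d2; rewrite divr_gt0.
have bound := sumK _ _ _ n10 (p01 n n0) np d1.
have /andP[lo hi] :=
  digraph_prob_structurally_diagonalizable n0 (p01 n n0) (q01 n n0) bound.
rewrite ger0_norm ?subr_ge0 // lerBlDr -lerBlDl (le_trans _ lo) //.
by rewrite lerD2l lerN2 ler_pdivrMr // mulrC -ler_pdivrMr.
Unshelve. all: by end_near.
Qed.
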